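(* Let $q$ be a power of a prime $p$, let $0\le j\le q-2$ and $n\ge1$ be integers, and put $k=2j+2+(n-1)(q-1)$ and $m\equiv j+1\pmod{q-1}$. For $\alpha\in\mathbb{Q}$ let $d(\alpha,k)$ denote the multiplicity of $\alpha$ as a slope of the Atkin operator $\mathbf{U}_t$ on $S^1_{k,m}(\Gamma_0(t))$, i.e. the number of roots of $t$-adic valuation $\alpha$ of the characteristic polynomial of $\mathbf{U}_t$ on this space. Let $\alpha\in\mathbb{Q}$. Then $$d(\alpha,k)\le2\left(\frac{\alpha-j-1}{q-1}\right)+1.$$
   Context: $K_\infty$ is the completion of $\mathbb{F}_q(t)$ at $\infty=1/t$, $\mathbb{C}_\infty$ is the completion of an algebraic closure of $K_\infty$, $\Omega=\mathbb{P}^1(\mathbb{C}_\infty)-\mathbb{P}^1(K_\infty)$. $\Gamma_0(t)=\{\begin{pmatrix}a&b\\c&d\end{pmatrix}\in GL_2(\mathbb{F}_q[t]):c\equiv0\bmod t\}$. $S^1_{k,m}(\Gamma_0(t))$ is the space of Drinfeld cusp forms of weight $k$ and type $m$: rigid analytic $\varphi:\Omega\to\mathbb{C}_\infty$ with $\varphi(\gamma z)(\det\gamma)^m(cz+d)^{-k}=\varphi(z)$ for all $\gamma=\begin{pmatrix}a&b\\c&d\end{pmatrix}\in\Gamma_0(t)$, holomorphic and vanishing at all cusps. $\mathbf{U}_t(\varphi)(z)=\sum_{b\in\mathbb{F}_q}\varphi\left(\frac{z+b}{t}\right)$. For $k,j,n,m$ as in the claim, $S^1_{k,m}(\Gamma_0(t))$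 has dimension $n$ and in a suitable basis (of harmonic cocycles) $\mathbf{U}_t$ has matrix $MD$, where $M=(m_{a,b})_{1\le a,b\le n}$ has entries in $\mathbb{F}_p$, $m_{a,b}=-\left[\binom{j+(n-a)(q-1)}{j+(n-b)(q-1)}+(-1)^{j+1}\binom{j+(n-a)(q-1)}{j+(b-1)(q-1)}\right]$ if $a\ne b$, $m_{a,a}=(-1)^j\binom{j+(n-a)(q-1)}{j+(a-1)(q-1)}$ (with $\binom{x}{y}=0$ if $y>x$), and $D=\mathrm{diag}(t^{s_1},\dots,t^{s_n})$ with $s_i=j+1+(i-1)(q-1)$. Slopes: the characteristic polynomial $P_{\mathbf{U}_t}(X)$ of $\mathbf{U}_t$ on $S^1_{k,m}(\Gamma_0(t))$ has coefficients in $\mathbb{F}_q[t]$; let $v_t$ be the $t$-adic valuation ($v_t(t)=1$), extended to an algebraic closure of $\mathbb{F}_q((t))$. For $\alpha\in\mathbb{Q}$, one says that $\alpha$ is a slope of multiplicity $d(\alpha,k)$ for $\mathbf{U}_t$ if exactly $d(\alpha,k)$ roots of $P_{\mathbf{U}_t}(X)$, counted with multiplicity, have $t$-adic valuation $\alpha$. The root $0$ does not contribute a slope.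
   Formalization: The bound is stated only for α that is a slope (d(α,k) ≥ 1); for arbitrary rational α it fails when d(α,k)=0 and the right side is negative, e.g. q=2, j=0, n=1, α=0 gives 0 ≤ −1. *)

(* Defs.v *)
From HB Require Import structures.
From mathcomp Require Import all_boot all_order all_algebra.
From mathcomp Require Import all_classical all_reals all_analysis.

Set Implicit Arguments.
Unset Strict Implicit.
Unset Printing Implicit Defensive.

Import Order.TTheory GRing.Theory Num.Theory.
Import numFieldNormedType.Exports.
Local Open Scope classical_set_scope.
Local Open Scope ring_scope.

(** * Formal power series

    [fps F] is the integral domain F[[t]], so [{fraction (fps F)}] is F((t)). *)

Record fps (F : fieldType) := FPS { fps_coef : nat -> F }.

HB.instance Definition _ (F : fieldType) := gen_eqMixin (fps F).
HB.instance Definition _ (F : fieldType) := gen_choiceMixin (fps F).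

Section FPS.
Variable F : fieldType.
Implicit Types s : fps F.

Lemma fpsP s1 s2 : fps_coef s1 =1 fps_coef s2 -> s1 = s2.
Proof. by case: s1 s2 => [f] [g] /= /funext ->. Qed.

Definition fps_of_poly (p : {poly F}) : fps F := FPS (fun i => p`_i).

Definition fps_trunc n s : {poly F} := \poly_(i < n) fps_coef s i.

Definition fps_zero : fps F := FPS (fun=> 0).
Definition fps_one : fps F := fps_of_poly 1.
Definition fps_opp s : fps F := FPS (fun i => - fps_coef s i).
Definition fps_add s1 s2 : fps F := FPS (fun i => fps_coef s1 i + fps_coef s2 i).
Definition fps_mul s1 s2 : fps F :=
  FPS (fun n => \sum_(i < n.+1) fps_coef s1 i * fps_coef s2 (n - i)%N).

Lemma fps_addA : associative fps_add.
Proof. by move=> a b c; apply: fpsP => i /=; rewrite addrA. Qed.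
Lemma fps_addC : commutative fps_add.
Proof. by move=> a b; apply: fpsP => i /=; rewrite addrC. Qed.
Lemma fps_add0 : left_id fps_zero fps_add.
Proof. by move=> a; apply: fpsP => i /=; rewrite add0r. Qed.
Lemma fps_addN : left_inverse fps_zero fps_opp fps_add.
Proof. by move=> a; apply: fpsP => i /=; rewrite addNr. Qed.

HB.instance Definition _ :=
  GRing.isZmodule.Build (fps F) fps_addA fps_addC fps_add0 fps_addN.

Lemma fps_trunc_coef n s i : (i < n)%N -> (fps_trunc n s)`_i = fps_coef s i.
Proof. by move=> lt_in; rewrite coef_poly lt_in. Qed.

Lemma fps_mul_trunc n s1 s2 i : (i < n)%N ->
  fps_coef (fps_mul s1 s2) i = (fps_trunc n s1 * fps_trunc n s2)`_i.
Proof.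
move=> lt_in; rewrite coefM; apply: eq_bigr => k _ /=.
rewrite !fps_trunc_coef //; first exact: leq_ltn_trans (leq_subr _ _) lt_in.
by apply: leq_ltn_trans lt_in; rewrite -ltnS.
Qed.

Lemma fps_mulA : associative fps_mul.
Proof.
move=> a b c; apply: fpsP => n.
pose T := fps_trunc n.+1.
transitivity ((T a * (T b * T c))`_n).
  rewrite coefM; apply: eq_bigr => i _; rewrite fps_trunc_coef //.
  by rewrite (@fps_mul_trunc n.+1) // ltnS leq_subr.
rewrite mulrA coefM; apply: eq_bigr => i _.
by rewrite (@fps_mul_trunc n.+1) // fps_trunc_coef // ltnS leq_subr.
Qed.

Lemma fps_mulC : commutative fps_mul.
Proof.
move=> a b; apply: fpsP => n.
by rewrite !(@fps_mul_trunc n.+1) // mulrC.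
Qed.

Lemma fps_mul1 : left_id fps_one fps_mul.
Proof.
move=> a; apply: fpsP => n /=; rewrite big_ord_recl /= coef1 mul1r subn0.
by rewrite big1 ?addr0 // => i _; rewrite coef1 /= mul0r.
Qed.

Lemma fps_mulDl : left_distributive fps_mul fps_add.
Proof.
move=> a b c; apply: fpsP => n /=.
by rewrite -big_split; apply: eq_bigr => i _; rewrite mulrDl.
Qed.

Lemma fps_1neq0 : fps_one != (0 : fps F).
Proof.
apply/eqP => /(congr1 (fun s => fps_coef s 0)) /=; rewrite coef1 /= => /eqP.
by rewrite oner_eq0.
Qed.

HB.instance Definition _ := GRing.Zmodule_isComNzRing.Build (fps F)
  fps_mulA fps_mulC fps_mul1 fps_mulDl fps_1neq0.

Definition fps_unit : {pred fps F} := fun s => `[< exists s', s' * s = 1 >].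
Definition fps_inv s : fps F :=
  if pselect (exists s', s' * s = 1) is left ex then projT1 (cid ex) else s.

Lemma fps_mulVs : {in fps_unit, left_inverse 1 fps_inv *%R}.
Proof.
move=> s /asboolP ex; rewrite /fps_inv; case: pselect => // ex'.
by case: (cid ex').
Qed.
Lemma fps_unitPl s s' : s' * s = 1 -> fps_unit s.
Proof. by move=> h; apply/asboolP; exists s'. Qed.
Lemma fps_inv_out : {in [predC fps_unit], fps_inv =1 id}.
Proof.
move=> s /negP h; rewrite /fps_inv; case: pselect => // ex.
by case: h; apply/asboolP.
Qed.

HB.instance Definition _ := GRing.ComNzRing_hasMulInverse.Build (fps F)
  fps_mulVs fps_unitPl fps_inv_out.

(* [fps_order s n] : the t-adic order of [s] is [n] (so [s] is nonzero). *)
Definition fps_order s n : Prop :=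
  fps_coef s n != 0 /\ forall i, (i < n)%N -> fps_coef s i = 0.

Lemma fps_order_ex s : s != 0 -> exists n, fps_order s n.
Proof.
move=> nz; have ex : exists n, fps_coef s n != 0.
  apply: contrapT => no; case/eqP: nz; apply: fpsP => i.
  by apply: contrapT => /eqP h; apply: no; exists i.
exists (ex_minn ex); case: ex_minnP => m hm min; split=> // i lt_im.
by apply/eqP; apply: contraTT lt_im => /min; rewrite -leqNgt.
Qed.

Lemma fps_integral : GRing.integral_domain_axiom (fps F).
Proof.
move=> a b ab0; apply: contrapT => /negP; rewrite negb_or => /andP[].
move=> /fps_order_ex[m [am ma]] /fps_order_ex[n [bn nb]].
have : fps_coef (a * b) (m + n)%N = 0 by rewrite ab0.
have lt_m : (m < (m + n).+1)%N by rewrite ltnS leq_addr.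
rewrite /= (bigD1 (Ordinal lt_m)) //= addKn big1 ?addr0.
  by move/eqP; rewrite mulf_eq0 (negPf am) (negPf bn).
move=> i ne_im; case: (ltngtP i m) => [/ma ->|lt_mi|eq_im]; first by rewrite mul0r.
  by rewrite nb ?mulr0 // ltn_subLR 1?addnC ?ltn_add2r // -ltnS.
by case/eqP: ne_im; apply: val_inj.
Qed.

HB.instance Definition _ :=
  GRing.ComUnitRing_isIntegral.Build (fps F) fps_integral.

End FPS.

(** * The t-adic valuation *)

(* [L] is, through [iL], an algebraic closure of F((t)), and [v] is the extension
   to [L] of the t-adic valuation. The value [v 0], which should be [+oo], is
   unconstrained and is never used. *)
Record is_tadic_closure (F : fieldType) (L : closedFieldType)
    (iL : {rmorphism {fraction (fps F)} -> L}) (v : L -> rat) : Prop := {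
  tadic_algebraic : forall x : L, exists2 p : {poly {fraction (fps F)}},
    p != 0 & root (map_poly iL p) x;
  tadic_valM : forall x y : L, x != 0 -> y != 0 -> v (x * y) = v x + v y;
  tadic_valD : forall x y : L, x != 0 -> y != 0 -> x + y != 0 ->
    Num.min (v x) (v y) <= v (x + y);
  tadic_val_fps : forall (s : fps F) (n : nat),
    fps_order s n -> v (iL (tofrac s)) = n%:R }.

(* Number of roots of [P] in [L], with multiplicity, of valuation [alpha];
   [closed_field_poly_normal] provides the list of the roots. *)
Definition slope_mult (F : fieldType) (L : closedFieldType)
    (iL : {rmorphism {fraction (fps F)} -> L}) (v : L -> rat)
    (P : {poly {poly F}}) (alpha : rat) : nat :=
  let PL := map_poly (fun f : {poly F} => iL (tofrac (fps_of_poly f))) P in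
  count (fun x => (x != 0) && (v x == alpha))
        (projT1 (closed_field_poly_normal PL)).

(* Upper bounds on the multiplicity that may become negative, such as
   2 (alpha - j - 1) / (q - 1) + 1, only make sense at an actual slope: where
   the multiplicity is 0 they fail for [alpha] small enough. *)
Definition is_slope (F : fieldType) (L : closedFieldType)
    (iL : {rmorphism {fraction (fps F)} -> L}) (v : L -> rat)
    (P : {poly {poly F}}) (alpha : rat) : Prop :=
  (0 < slope_mult iL v P alpha)%N.

(** * Drinfeld cusp forms *)

Section Drinfeld.

Variables (F : finFieldType) (R : realType) (C : fieldType).
Variables (iC : {rmorphism {fraction {poly F}} -> C}) (abs : C -> R).

Local Notation q := (#|F|).

Definition polyC_infty (f : {poly F}) : C := iC (tofrac f).
Local Notation "f %:C" := (polyC_infty f) (at level 2, format "f %:C").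

(* In a complete [C], the topological closure of the image of F_q(t) is the
   completion of F_q(t) for the absolute value induced by [abs]. *)
Definition K_infty : set C :=
  [set x | forall e : R, 0 < e -> exists f, abs (x - iC f) < e].

Definition algebraic_K_infty : set C :=
  [set x | exists p : {poly C}, [/\ p != 0, forall i, K_infty p`_i & root p x]].

(* [C] is the completion of an algebraic closure of K_infty. *)
Record is_C_infty : Prop := {
  C_infty_abs_ge0 : forall x, 0 <= abs x;
  C_infty_abs_eq0 : forall x, abs x = 0 <-> x = 0;
  C_infty_absM : forall x y, abs (x * y) = abs x * abs y;
  C_infty_absD : forall x y, abs (x + y) <= Num.max (abs x) (abs y);
  C_infty_abs_poly : forall f : {poly F}, f != 0 ->
    abs f%:C = q%:R ^+ (size f).-1;
  C_infty_complete : forall u : nat -> C,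
    (forall e : R, 0 < e -> exists N, forall m n, (N <= m)%N -> (N <= n)%N ->
      abs (u m - u n) < e) ->
    exists l, abs (u n - l) @[n --> \oo] --> (0 : R);
  C_infty_closed : forall p : {poly C}, (1 < size p)%N ->
    (forall i, algebraic_K_infty p`_i) ->
    exists2 x, algebraic_K_infty x & root p x;
  C_infty_dense : forall (x : C) (e : R), 0 < e ->
    exists2 y, algebraic_K_infty y & abs (x - y) < e }.

Definition C_lim (u : nat -> C) (l : C) : Prop :=
  abs (u n - l) @[n --> \oo] --> (0 : R).

(* The point at infinity lies in P^1(K_infty), so Omega is a subset of [C]. *)
Definition Omega : set C := ~` K_infty.

Definition imag_abs (z : C) : R := inf [set abs (z - x) | x in K_infty].

(* The affinoids that exhaust Omega. *)
Definition Omega_aff (N : nat) : set C :=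
  [set z | abs z <= q%:R ^+ N /\ q%:R ^- N <= imag_abs z].

(* On each affinoid [phi] is a uniform limit of rational functions without
   poles there. *)
Definition rigid_analytic (phi : C -> C) : Prop :=
  forall (N : nat) (e : R), 0 < e -> exists g h : {poly C},
    forall z, Omega_aff N z ->
      h.[z] != 0 /\ abs (phi z - g.[z] / h.[z]) < e.

Definition Gamma0 (g : 'M[{poly F}]_2) : bool :=
  (g \in unitmx) && ('X %| g 1 0).

(* phi(gz) det(g)^m (cz+d)^(-k) *)
Definition slash (k : nat) (m : int) (phi : C -> C) (g : 'M[{poly F}]_2)
    (z : C) : C :=
  let j := (g 1 0)%:C * z + (g 1 1)%:C in
  phi (((g 0 0)%:C * z + (g 0 1)%:C) / j) * (\det g)%:C ^ m * j ^- k.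

(* The lattice of the translations [z |-> z + b] in g^-1 Gamma_0(t) g. *)
Definition cusp_lattice (g : 'M[{poly F}]_2) : pred {poly F} :=
  fun b => Gamma0 (g *m (1%:M + b *: delta_mx 0 1) *m invmx g).

(* e_Lambda(z) = z * prod_(0 <> l in Lambda) (1 - z / l), as the limit of the
   products over the [l] of degree smaller than [d]. *)
Definition lattice_exp (Lambda : pred {poly F}) (z : C) : C :=
  xget 0 (C_lim (fun d =>
    z * \prod_(l : 'rV[F]_d | (rVpoly l != 0) && Lambda (rVpoly l))
          (1 - z / (rVpoly l)%:C))).

(* Near the cusp [g oo], phi|g is a power series without constant term in the
   parameter u = 1 / e_Lambda(z). The usual parameter differs from u by a factor
   (the Carlitz period), which only rescales the coefficients. *)
Definition vanishes_at_cusp (k : nat) (m : int) (phi : C -> C)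
    (g : 'M[{poly F}]_2) : Prop :=
  exists (a : nat -> C) (r : R), a 0%N = 0 /\
    forall z, Omega z -> r < imag_abs z ->
      C_lim (fun N => \sum_(i < N) a i * (lattice_exp (cusp_lattice g) z) ^- i)
            (slash k m phi g z).

(* S^1_{k,m}(Gamma_0(t)). Functions on Omega are encoded as functions on [C]
   that are zero outside Omega. Every cusp is of the form [g oo] with [g] in
   GL_2(F_q[t]). *)
Record cusp_form (k : nat) (m : int) (phi : C -> C) : Prop := {
  cusp_form_support : forall z, ~ Omega z -> phi z = 0;
  cusp_form_analytic : rigid_analytic phi;
  cusp_form_modular : forall g, Gamma0 g -> forall z, Omega z ->
    slash k m phi g z = phi z;
  cusp_form_vanish : forall g, g \in unitmx -> vanishes_at_cusp k m phi g }.

Definition Ut (phi : C -> C) (z : C) : C :=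
  \sum_(b : F) phi ((z + (b%:P)%:C) / 'X%:C).

(** * Matrices of an operator on a space of functions *)

Definition is_basis (S : (C -> C) -> Prop) (n : nat) (e : 'I_n -> C -> C) :
    Prop :=
  (forall i, S (e i)) /\
  forall phi, S phi ->
    exists! c : 'rV[C]_n, forall z, phi z = \sum_(i < n) c 0 i * e i z.

(* Column [b] of [A] contains the coordinates of [U (e b)]. *)
Definition has_matrix (U : (C -> C) -> C -> C) (n : nat) (e : 'I_n -> C -> C)
    (A : 'M[C]_n) : Prop :=
  forall b z, U (e b) z = \sum_(a < n) A a b * e a z.

(* [P] is the characteristic polynomial of [Ut] on S^1_{k,m}(Gamma_0(t)), seen
   as a polynomial with coefficients in F_q[t]. *)
Definition is_char_poly_Ut (k : nat) (m : int) (P : {poly {poly F}}) : Prop :=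
  exists (n : nat) (e : 'I_n -> C -> C) (A : 'M[C]_n),
    [/\ is_basis (cusp_form k m) e, has_matrix Ut e A
      & map_poly polyC_infty P = char_poly A].

(* The matrices M and D; the rows and columns are numbered from 0. *)
Definition Mmx (n j : nat) : 'M[F]_n :=
  \matrix_(a < n, b < n)
    let x := (j + (n - a.+1) * q.-1)%N in
    if a == b then (-1) ^+ j * 'C(x, j + a * q.-1)%:R
    else - ('C(x, j + (n - b.+1) * q.-1)%:R
            + (-1) ^+ j.+1 * 'C(x, j + b * q.-1)%:R).

Definition Dmx (n j : nat) : 'M[{poly F}]_n :=
  diag_mx (\row_(i < n) 'X^(j.+1 + i * q.-1)).

(* Teitelbaum's isomorphism with harmonic cocycles provides such a basis when
   k = 2j + 2 + (n - 1)(q - 1) and m = j + 1 mod q - 1. *)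
Definition Ut_has_matrix_MD (k : nat) (m : int) (n j : nat) : Prop :=
  exists e : 'I_n -> C -> C,
    is_basis (cusp_form k m) e /\
    has_matrix Ut e
      (map_mx polyC_infty (map_mx polyC (Mmx n j) *m Dmx n j)).

End Drinfeld.

(* Main.v *)
(** Let [N] be the number of nonzero roots of valuation at most [alpha]. The
    coefficient of X^(n-N) of the characteristic polynomial has valuation at most
    [N alpha], since one term of the elementary symmetric function dominates. On
    the other hand column [b] of [M D] is divisible by [t^(s_b)], so by the Leibniz
    formula this coefficient is divisible by [t^w], where
    [w = N (j+1) + (q-1) N (N-1) / 2] is the sum of the [N] smallest [s_b]. Hence
    [w <= N alpha]; since [alpha] is a slope, [N > 0], so that
    [N <= 2 (alpha - j - 1) / (q - 1) + 1], and [N] bounds the multiplicity of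
    [alpha]. *)

Require Import Defs.
From mathcomp Require Import all_boot all_order all_algebra.
From mathcomp Require Import all_classical all_reals all_analysis.
From mathcomp Require Import perm lra zify.

Set Implicit Arguments.
Unset Strict Implicit.
Unset Printing Implicit Defensive.

Import Order.TTheory GRing.Theory Num.Theory.
Local Open Scope ring_scope.

(** * Divisibility of characteristic polynomial coefficients by powers of t *)

(** Induction on [n]: with c indices below [n], adding [n] raises the binomial by c and the sum by
    [n]. The second conjunct, c <= [n], is carried along for this step. *)
Lemma bin2_count_leq_sum n (J : pred nat) :
  ('C(\sum_(i < n | J i) 1, 2) <= \sum_(i < n | J i) i)%N /\
  (\sum_(i < n | J i) 1 <= n)%N.
Proof.
elim: n => [|n [IH1 IH2]]; first by rewrite !big_ord0.
rewrite !(big_mkcond (fun i : 'I_n.+1 => J i)) !big_ord_recr -!big_mkcond /=.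
case: (J n).
  by rewrite !addn1 binS bin1 leq_add.
by rewrite !addn0 (leq_trans IH2).
Qed.

Lemma bin2_card_leq_sum n (J : {set 'I_n}) :
  ('C(#|J|, 2) <= \sum_(i in J) i)%N.
Proof.
pose P i := if insub i is Some k then k \in J else false.
have PJ (i : 'I_n) : P i = (i \in J) by rewrite /P valK.
have [+ _] := bin2_count_leq_sum n P.
by rewrite (eq_bigl _ _ PJ) (eq_bigl _ _ PJ) sum1_card.
Qed.

(** In the Leibniz expansion, each column [b] from which an entry of [A] is taken instead of the
    indeterminate contributes a factor t^(s b). The coefficient of degree [n - N] collects the terms
    with exactly [N] such columns. *)
Lemma dvdp_Xn_char_poly_coef (F : fieldType) n (A : 'M[{poly F}]_n)
    (s : 'I_n -> nat) N w :
  (forall a b, 'X^(s b) %| A a b) ->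
  (forall J : {set 'I_n}, #|J| = N -> (w <= \sum_(b in J) s b)%N) ->
  (N <= n)%N -> 'X^w %| (char_poly A)`_(n - N).
Proof.
(* Transposing makes the Leibniz products run over columns, where the divisibility is known. *)
move=> dvdA leS leNn; rewrite /char_poly -det_tr /determinant coef_sum.
apply: (big_ind (fun c => 'X^w %| c)) => [|x y|sg _]; first exact: dvdp0.
  exact: dvdp_add.
rewrite mulr_sign (_ : \prod_i _ = \prod_i
    ((sg i == i)%:R%:P * 'X + (- A (sg i) i)%:P)); last first.
  by apply: eq_bigr => i _; rewrite !mxE mul_polyC scaler_nat polyCN.
rewrite (bigA_distr _ _ (fun i => (sg i == i)%:R%:P * 'X)
  (fun i => (- A (sg i) i)%:P)); set f := \sum_(J in _) _.
suff : 'X^w %| f`_(n - N) by case: ifP; rewrite ?coefN ?dvdpNr.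
rewrite /f coef_sum.
apply: (big_ind (fun c => 'X^w %| c)) => [|x y|J _]; first exact: dvdp0.
  exact: dvdp_add.
(* [J] is the set of columns contributing the indeterminate; [c i] is what remains of the factor of
   column [i]. *)
pose c i := if i \in J then (sg i == i)%:R else - A (sg i) i.
rewrite (_ : \prod_i _ = (\prod_i c i)%:P * 'X^#|J|); last first.
  rewrite rmorph_prod -prodr_const [X in _ * X]big_mkcond -big_split.
  by apply: eq_bigr => i _; rewrite /c; case: ifP; rewrite /= ?mulr1.
rewrite coefCM coefXn; case: eqP => [cJ|]; last by rewrite mulr0 dvdp0.
have /leS : #|~: J| = N by have := cardsC J; rewrite card_ord; lia.
rewrite mulr1 => /(dvdp_exp2l 'X)/dvdp_trans; apply.
rewrite big_mkcond -prodrXr; apply: (big_ind2 (fun a b : {poly F} => a %| b)).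
- exact: dvdpp.
- by move=> *; apply: dvdp_mul.
- by move=> i _; rewrite /c inE; case: (i \in J) => /=;
    rewrite ?expr0 ?dvd1p ?dvdpNr ?dvdA.
Qed.

(** * Independence of the characteristic polynomial from the basis *)

Lemma is_basis_coord1 (C : fieldType) (S : (C -> C) -> Prop) n
    (e : 'I_n -> C -> C) (X : 'M[C]_n) :
  is_basis S e -> (forall b z, e b z = \sum_(a < n) X a b * e a z) -> X = 1%:M.
Proof.
move=> [Se ue] eX; apply/matrixP => a b.
have [c [_ uc]] := ue _ (Se b).
have c1 : c = \row_a (a == b)%:R.
  apply: uc => z; rewrite (bigD1 b) //= mxE eqxx mul1r big1 ?addr0 //.
  by move=> i /negPf ib; rewrite mxE ib mul0r.
have cX : c = \row_a X a b.
  by apply: uc => z; rewrite eX; apply: eq_bigr => i _; rewrite mxE.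
by have := congr1 (fun r : 'rV_n => r 0 a) (etrans (esym cX) c1); rewrite !mxE.
Qed.

Lemma is_basis_change (C : fieldType) (S : (C -> C) -> Prop) n n'
    (e : 'I_n -> C -> C) (e' : 'I_n' -> C -> C) :
  is_basis S e -> is_basis S e' ->
  exists Q : 'M[C]_(n', n), forall b z, e b z = \sum_(a < n') Q a b * e' a z.
Proof.
move=> [Se _] [_ ue']; have /choice[c hc] b := ue' _ (Se b).
exists (\matrix_(a, b) c b 0 a) => b z; rewrite (hc b).1.
by under [RHS]eq_bigr do rewrite mxE.
Qed.

Lemma coord_comp (C : fieldType) n n' m (e : 'I_n -> C -> C)
    (e' : 'I_n' -> C -> C) (f : 'I_m -> C -> C)
    (Q : 'M[C]_(n', n)) (T : 'M[C]_(m, n')) :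
  (forall b z, e b z = \sum_(a < n') Q a b * e' a z) ->
  (forall b z, e' b z = \sum_(a < m) T a b * f a z) ->
  forall b z, e b z = \sum_(a < m) (T *m Q) a b * f a z.
Proof.
move=> eQ e'T b z; rewrite eQ; under eq_bigr do rewrite e'T mulr_sumr.
rewrite exchange_big; apply: eq_bigr => a _; rewrite mxE mulr_suml.
by apply: eq_bigr => i _; rewrite mulrCA mulrA.
Qed.

Lemma is_basis_coordK (C : fieldType) (S : (C -> C) -> Prop) n n'
    (e : 'I_n -> C -> C) (e' : 'I_n' -> C -> C)
    (Q : 'M[C]_(n', n)) (Q' : 'M[C]_(n, n')) :
  is_basis S e ->
  (forall b z, e b z = \sum_(a < n') Q a b * e' a z) ->
  (forall b z, e' b z = \sum_(a < n) Q' a b * e a z) -> Q' *m Q = 1%:M.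
Proof.
by move=> Be eQ eQ'; apply: (is_basis_coord1 Be); apply: coord_comp eQ eQ'.
Qed.

(** Taking determinants in Q(X - A) = (X - A')Q over [{poly C}], the nonzero constant det Q
    cancels. *)
Lemma char_poly_intertwine (C : fieldType) n (A A' Q : 'M[C]_n) :
  Q \in unitmx -> Q *m A = A' *m Q -> char_poly A = char_poly A'.
Proof.
rewrite unitmxE unitfE => nzQ QA.
have nzQP : \det (map_mx polyC Q) != 0 by rewrite det_map_mx polyC_eq0.
apply: (mulfI nzQP).
rewrite [RHS]mulrC /char_poly -!det_mulmx /char_poly_mx mulmxBl mulmxBr.
by rewrite -!map_mxM QA scalar_mxC.
Qed.

Lemma char_poly_basis_indep (F : finFieldType) (C : fieldType)
    (iC : {rmorphism {fraction {poly F}} -> C}) (S : (C -> C) -> Prop) n n'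
    (e : 'I_n -> C -> C) (e' : 'I_n' -> C -> C) A A' :
  is_basis S e -> is_basis S e' ->
  has_matrix (Ut iC) e A -> has_matrix (Ut iC) e' A' ->
  char_poly A = char_poly A'.
Proof.
move=> Be Be' UA UA'.
have [Q eQ] := is_basis_change Be Be'; have [Q' eQ'] := is_basis_change Be' Be.
have Q'Q := is_basis_coordK Be eQ eQ'; have QQ' := is_basis_coordK Be' eQ' eQ.
have enn : n = n'.
  by apply/eqP; rewrite eqn_leq (mulmx1_min Q'Q) (mulmx1_min QQ').
subst n'; apply: (@char_poly_intertwine _ _ _ _ Q).
  by case/mulmx1_unit: QQ'.
have UQA := coord_comp UA eQ.
have UAQ : forall b z, Ut iC (e b) z = \sum_(a < n) (A' *m Q) a b * e' a z.
  apply: coord_comp UA' => b z; rewrite /Ut; under eq_bigr do rewrite eQ.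
  by rewrite exchange_big; under [RHS]eq_bigr do rewrite mulr_sumr.
(* [is_basis] gives unique coordinates only to members of [S], such as [e' b]. The columns of
   [Q *m A - A' *m Q] are relations among the [e']; added to the trivial coordinates of [e' b] they
   must therefore vanish. *)
have /(is_basis_coord1 Be') : forall b z,
    e' b z = \sum_(a < n) (1%:M + (Q *m A - A' *m Q)) a b * e' a z.
  move=> b z; under eq_bigr do rewrite mxE mulrDl.
  rewrite big_split /= (bigD1 b) //= mxE eqxx mul1r.
  rewrite [X in _ + X + _]big1 => [|i /negPf ib]; last by rewrite mxE ib mul0r.
  rewrite addr0 [X in _ + X](_ : _ = 0) ?addr0 //.
  under eq_bigr do rewrite mxE [(- (_ *m _)) _ _]mxE mulrBl.
  by rewrite big_split sumrN; apply/eqP; rewrite subr_eq0 -UQA UAQ.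
by move/eqP; rewrite -subr_eq0 addrC addKr subr_eq0 => /eqP.
Qed.

(** * Valuations and the Newton polygon of a split polynomial *)

Section Valuation.
Variables (L : fieldType) (v : L -> rat).
Hypothesis vM : forall x y : L, x != 0 -> y != 0 -> v (x * y) = v x + v y.
Hypothesis vD : forall x y : L, x != 0 -> y != 0 -> x + y != 0 ->
  Num.min (v x) (v y) <= v (x + y).
Implicit Types (x y r : L) (a b : rat).

(* Bounds on the valuation, with the convention [v 0 = +oo]. *)
Definition vge x a := (x == 0) || (a <= v x).
Definition vgt x a := (x == 0) || (a < v x).

(** From (-1)(-1) = 1 follows 2 v(-1) = v(1) = 0. *)
Lemma valuationN x : x != 0 -> v (- x) = v x.
Proof.
move=> nx; have n1 : - 1 != 0 :> L by rewrite oppr_eq0 oner_eq0.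
have v1 := vM (oner_neq0 L) (oner_neq0 L).
have vN1 := vM n1 n1; rewrite mulrNN mulr1 in v1 vN1.
by rewrite -mulN1r vM //; lra.
Qed.

Lemma vgeN x a : vge (- x) a = vge x a.
Proof.
by rewrite /vge oppr_eq0; case: (eqVneq x 0) => //= nx; rewrite valuationN.
Qed.

Lemma vgtN x a : vgt (- x) a = vgt x a.
Proof.
by rewrite /vgt oppr_eq0; case: (eqVneq x 0) => //= nx; rewrite valuationN.
Qed.

Lemma vgeW a b x : a <= b -> vge x b -> vge x a.
Proof.
by rewrite /vge /vgt => ab /orP[->//|/(le_trans ab) h];
  rewrite h orbT.
Qed.

Lemma vgtW a b x : a <= b -> vgt x b -> vgt x a.
Proof.
by rewrite /vge /vgt => ab /orP[->//|/(le_lt_trans ab) h];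
  rewrite h orbT.
Qed.

Lemma vgt_ge a x : vgt x a -> vge x a.
Proof. by rewrite /vge /vgt => /orP[->//|/ltW->]; rewrite orbT. Qed.

Lemma vgeD x y a : vge x a -> vge y a -> vge (x + y) a.
Proof.
rewrite /vge; case: (eqVneq x 0) => [->|nx]; first by rewrite add0r.
case: (eqVneq y 0) => [->|ny]; first by rewrite addr0 (negPf nx).
case: (eqVneq (x + y) 0) => //= nxy ax ay.
by apply: le_trans (vD nx ny nxy); rewrite le_min ax.
Qed.

Lemma vgtD x y a : vgt x a -> vgt y a -> vgt (x + y) a.
Proof.
rewrite /vgt; case: (eqVneq x 0) => [->|nx]; first by rewrite add0r.
case: (eqVneq y 0) => [->|ny]; first by rewrite addr0 (negPf nx).
case: (eqVneq (x + y) 0) => //= nxy ax ay.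
by apply: lt_le_trans (vD nx ny nxy); rewrite lt_min ax.
Qed.

Lemma vgeM r x a b : vge r a -> vge x b -> vge (r * x) (a + b).
Proof.
rewrite /vge mulf_eq0; case: (eqVneq r 0) => //= nr.
by case: (eqVneq x 0) => //= nx ar bx; rewrite vM // lerD.
Qed.

Lemma vgtM r x a b : vgt r a -> vge x b -> vgt (r * x) (a + b).
Proof.
rewrite /vge /vgt mulf_eq0; case: (eqVneq r 0) => //= nr.
by case: (eqVneq x 0) => //= nx ar bx; rewrite vM // ltr_leD.
Qed.

Lemma vgeMt r x a b : vge r a -> vgt x b -> vgt (r * x) (a + b).
Proof.
rewrite /vge /vgt mulf_eq0; case: (eqVneq r 0) => //= nr.
by case: (eqVneq x 0) => //= nx ar bx; rewrite vM // ler_ltD.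
Qed.

Lemma valuation_dominant x y a :
  x != 0 -> v x <= a -> vgt y a -> x + y != 0 /\ v (x + y) <= a.
Proof.
rewrite /vgt => nx xa.
case: (eqVneq y 0) => [->|ny /= ay]; first by rewrite addr0.
have nxy : x + y != 0.
  apply: contraTneq ay => /eqP; rewrite addr_eq0 => /eqP xy.
  by rewrite -leNgt; move: xa; rewrite xy valuationN.
split=> //; have nNy : - y != 0 by rewrite oppr_eq0.
(* The ultrametric inequality is applied to x = (x + y) + (- y); the minimum cannot be v(y), which
   exceeds v(x). *)
have := vD nxy nNy; rewrite addrK ge_min valuationN // => /(_ nx)/orP[|]; lra.
Qed.

Definition small_root alpha r := (r != 0) && (v r <= alpha).

(* The product of the roots of valuation at most [alpha] is the unique term of
   least valuation in the corresponding elementary symmetric function; the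
   bounds on the other coefficients say that the Newton polygon lies above the
   line of slope [alpha] through this vertex. *)
Lemma prod_XsubC_coef_valuation alpha rs :
  let f := \prod_(r <- rs) ('X - r%:P) in
  let m := count (predC (small_root alpha)) rs in
  exists V : rat,
    [/\ V <= (count (small_root alpha) rs)%:R * alpha,
        forall i, vge f`_i (V + (m%:R - i%:R) * alpha),
        forall i, (i < m)%N -> vgt f`_i (V + (m%:R - i%:R) * alpha),
        f`_m != 0 & v f`_m <= V].
Proof.
elim: rs => [|r rs /= [V]].
  have v1 := vM (oner_neq0 L) (oner_neq0 L); rewrite mulr1 in v1.
  rewrite /= big_nil; exists 0; rewrite mul0r lexx coef1 eqxx oner_neq0.
  split=> //; last by lra.
  move=> [|i]; rewrite coef1 /vge ?eqxx //=.
  by rewrite oner_eq0 /=; lra.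
rewrite big_cons; set f := \prod_(j <- rs) _; set m := count (predC _) rs.
move=> [leV fge fgt nfm fm].
have fE i : (('X - r%:P) * f)`_i = (if i == 0 then 0 else f`_i.-1) - r * f`_i.
  by rewrite mulrBl coefB coefXM coefCM.
have [sr|nsr] := boolP (small_root alpha r); rewrite /=.
  (* A small root leaves [m] unchanged and adds [v r] to [V]: in degree [m], the term [- r * f_m]
     dominates [f_(m-1)]. *)
  have /andP[nr ra] := sr.
  have rge : vge r (v r) by rewrite /vge lexx orbT.
  rewrite add0n; exists (V + v r).
  have [nf'm f'm] : (('X - r%:P) * f)`_m != 0 /\
      v (('X - r%:P) * f)`_m <= V + v r.
    rewrite fE addrC; apply: valuation_dominant.
    - by rewrite oppr_eq0 mulf_neq0.
    - by rewrite valuationN ?mulf_neq0 // vM //; lra.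
    - case: (m) fgt => [|k] fgt; first by rewrite /vgt eqxx.
      by apply: vgtW (fgt k (ltnSn k)); rewrite -natr1; lra.
  split=> // [|i|i im].
  - by rewrite natrD mulrDl mul1r; lra.
  - rewrite fE; apply: vgeD.
      case: i => [|i]; first by rewrite /vge eqxx.
      by apply: vgeW (fge i); rewrite -natr1; lra.
    by rewrite vgeN; apply: vgeW (vgeM rge (fge i)); lra.
  - rewrite fE; apply: vgtD.
      case: i im => [|i] im; first by rewrite /vgt eqxx.
      by apply: vgtW (fgt i (ltnW im)); rewrite -natr1; lra.
    by rewrite vgtN; apply: vgtW (vgeMt rge (fgt i im)); lra.
(* Any other root, possibly 0, raises [m] by one and keeps [V]: in degree [m + 1], the term [f_m]
   dominates [r * f_(m+1)]. *)
have rgt : vgt r alpha.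
  by move: nsr; rewrite /small_root /vgt; case: eqVneq => //= _; rewrite -ltNge.
rewrite add0n add1n; exists V.
have [nf'm f'm] : (('X - r%:P) * f)`_m.+1 != 0 /\
    v (('X - r%:P) * f)`_m.+1 <= V.
  rewrite fE; apply: valuation_dominant => //.
  rewrite vgtN.
  by apply: vgtW (vgtM rgt (fge m.+1)); rewrite -natr1; lra.
split=> // i => [|im].
- rewrite fE; apply: vgeD.
    case: i => [|i]; first by rewrite /vge eqxx.
    by apply: vgeW (fge i); rewrite -!natr1; lra.
  rewrite vgeN; apply: vgt_ge; apply: vgtW (vgtM rgt (fge i)).
  by rewrite -natr1; lra.
- rewrite fE; apply: vgtD.
    case: i im => [|i] im; first by rewrite /vgt eqxx.
    by apply: vgtW (fgt i im); rewrite -!natr1; lra.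
  by rewrite vgtN; apply: vgtW (vgtM rgt (fge i)); rewrite -natr1; lra.
Qed.

End Valuation.

(** * Transfer to the matrix M D and the bound on slopes *)

Lemma valuation_fps_of_poly_ge (F : fieldType) (L : closedFieldType)
    (iL : {rmorphism {fraction (fps F)} -> L}) (v : L -> rat)
    (hL : is_tadic_closure iL v) (f : {poly F}) w :
  f != 0 -> 'X^w %| f -> w%:R <= v (iL (tofrac (fps_of_poly f))).
Proof.
move=> nf /dvdpP[g fg].
have /fps_order_ex[d fd] : fps_of_poly f != 0.
  apply: contraNneq nf => f0; apply/eqP/polyP => i.
  by rewrite -[f`_i]/(fps_coef (fps_of_poly f) i) f0 coef0.
rewrite (tadic_val_fps hL fd) ler_nat leqNgt; apply/negP => dw.
by case: fd => /=; rewrite fg coefMXn dw eqxx.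
Qed.

(** The two polynomials agree over [C] by independence of the basis, and F_q[t] embeds into [C]. *)
Lemma is_char_poly_Ut_MD (F : finFieldType) (R : realType) (C : fieldType)
    (iC : {rmorphism {fraction {poly F}} -> C}) (abs : C -> R) k m n j P :
  Ut_has_matrix_MD iC abs k m n j -> is_char_poly_Ut iC abs k m P ->
  P = char_poly (map_mx polyC (Mmx F n j) *m Dmx F n j).
Proof.
move=> [e [Be Ue]] [n' [e' [A [Be' Ue' PA]]]].
pose f : {rmorphism {poly F} -> C} := iC \o @tofrac {poly F}.
apply: (@map_inj_poly _ _ f).
  by move=> x y /= /fmorph_inj/eqP; rewrite tofrac_eq => /eqP.
  exact: rmorph0.
rewrite map_char_poly -[LHS]/(map_poly (polyC_infty iC) P) PA.
exact: char_poly_basis_indep Be' Be Ue' Ue.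
Qed.

Theorem theorem6p5
  (F : finFieldType) (p q : nat) (hp : prime p) (hpF : p \in [pchar F])
  (hq : #|F| = q)
  (R : realType) (C : fieldType) (iC : {rmorphism {fraction {poly F}} -> C})
  (abs : C -> R) (hC : is_C_infty iC abs)
  (L : closedFieldType) (iL : {rmorphism {fraction (fps F)} -> L})
  (v : L -> rat) (hL : is_tadic_closure iL v)
  (j n k : nat) (m : int)
  (hj : (j <= q - 2)%N) (hn : (1 <= n)%N)
  (hk : k = (2 * j + 2 + (n - 1) * (q - 1))%N)
  (hm : (m = Posz j.+1 %[mod Posz (q - 1)])%Z)
  (hMD : Ut_has_matrix_MD iC abs k m n j)
  (P : {poly {poly F}}) (hP : is_char_poly_Ut iC abs k m P)
  (alpha : rat) (halpha : is_slope iL v P alpha) :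
  (slope_mult iL v P alpha)%:R
    <= 2 * ((alpha - j%:R - 1) / (q%:R - 1)) + 1.
Proof.
have PE := is_char_poly_Ut_MD hMD hP.
have Pmonic : lead_coef P = 1 by rewrite PE; apply/monicP/char_poly_monic.
(* As [P] is monic, [g 0 = 0] and [g 1 = 1] suffice to carry its degree and coefficients over to
   [L]. *)
pose g (f : {poly F}) : L := iL (tofrac (fps_of_poly f)).
have g0 : g 0 = 0.
  rewrite /g (_ : fps_of_poly 0 = 0) ?rmorph0 //.
  by apply: fpsP => i; rewrite /= coef0.
have g1 : g 1 = 1 by rewrite /g -[fps_of_poly 1]/(1 : fps F) !rmorph1.
move: halpha; rewrite /is_slope /slope_mult -/g.
case: closed_field_poly_normal => rs /= rsE.
have lead1 : lead_coef (map_poly g P) = 1.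
  by rewrite lead_coef_map_id0 // Pmonic g1 // oner_eq0.
rewrite lead1 scale1r in rsE.
(* The list [rs] also contains the root 0 with its multiplicity, so its length is the full
   dimension. *)
have szrs : size rs = n.
  apply: succn_inj.
  rewrite -(size_char_poly (map_mx polyC (Mmx F n j) *m Dmx F n j)) -PE
    -(@size_map_poly_id0 _ _ g P) ?Pmonic ?g1 ?oner_eq0 //.
  by rewrite rsE size_prod_XsubC.
set d := count _ rs => d_gt0.
have [V [VN _ _ nz leV]] :=
  prod_XsubC_coef_valuation (tadic_valM hL) (tadic_valD hL) alpha rs.
set N := count _ rs in VN.
have dN : (d <= N)%N.
  by apply: sub_count => x /andP[nx /eqP xa]; rewrite /small_root nx xa lexx.
have Nn : (N <= n)%N by rewrite -szrs count_size.
have coN : count (predC (small_root v alpha)) rs = (n - N)%N.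
  by rewrite -szrs -(count_predC (small_root v alpha)) addKn.
rewrite -rsE coef_map_id0 // coN in nz leV.
have q_gt1 : (1 < q)%N by rewrite -hq card_finNzRing_gt1.
pose w := (N * j.+1 + 'C(N, 2) * q.-1)%N.
have dvdP : 'X^w %| P`_(n - N).
  rewrite PE; apply: (dvdp_Xn_char_poly_coef
    (s := fun b => (j.+1 + b * q.-1)%N)) => //.
    by move=> a b; rewrite mul_mx_diag !mxE hq dvdp_mull.
  move=> J cJ; rewrite /w -cJ big_split /= sum_nat_const -big_distrl /=.
  by rewrite leq_add2l leq_mul2r bin2_card_leq_sum orbT.
have nP : P`_(n - N) != 0 by apply: contraNneq nz => ->; rewrite g0.
(* The chain is w <= v(coefficient) <= V <= N alpha. *)
have wNa := le_trans (valuation_fps_of_poly_ge hL nP dvdP) (le_trans leV VN).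
(* Doubling clears the denominator of N(N-1)/2 and exhibits the factor [N] to be cancelled. *)
have wE : (2 * w = N * (2 * j.+1 + N.-1 * q.-1))%N.
  have bE : (2 * 'C(N, 2) = N * N.-1)%N by rewrite -mul_bin_diag bin1.
  by rewrite /w !mulnDr (mulnA 2 'C(N, 2)) bE -mulnA mulnCA.
have N_gt0 := leq_trans d_gt0 dN.
have ineq : (2 * j.+1 + N.-1 * q.-1)%:R <= 2 * alpha :> rat.
  rewrite -(ler_pM2l (x := N%:R)) ?ltr0n // -natrM -wE natrM; lra.
have qn : q%:R = q.-1%:R + 1 :> rat by rewrite natr1 prednK // ltnW.
have q1_gt0 : 0 < q.-1%:R :> rat by rewrite ltr0n; lia.
apply: (@le_trans _ _ N%:R); first by rewrite ler_nat.
rewrite -(prednK N_gt0) -natr1 lerD2r qn addrK mulrA ler_pdivlMr //.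
by move: ineq; rewrite natrD !natrM -natr1; lra.
Qed.
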